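(* Let $d=(d_1,d_2)\in\mathbb{R}^2$ with $d_1\ge 0$, $d_2\ge 0$, $d_1d_2\ge 1$, and let $$\mathcal Z_+=\left\{(x,y,t)\in\mathcal I_2\times\mathbb{R}_+:\ t\ge d_1y_1^2+2y_1y_2+d_2y_2^2\right\}.$$ Then $\operatorname{cl}\operatorname{conv}(\mathcal Z_+)$ is the set of all $(x,y,t)\in[0,1]^2\times\mathbb{R}^3_+$ (with $x=(x_1,x_2)$, $y=(y_1,y_2)$) for which there exist $\lambda\in\mathbb{R}_+$ and $z\in\mathbb{R}^2_+$ such that $$x_1+x_2-1\le\lambda\le\min\{x_1,x_2\}$$ and $$t\ge\frac{d_1(y_1-z_1)^2}{x_1-\lambda}+\frac{d_2(y_2-z_2)^2}{x_2-\lambda}+\frac{d_1z_1^2+2z_1z_2+d_2z_2^2}{\lambda}.$$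
   Context: $\mathcal I_2=\{(x,y)\in\{0,1\}^2\times\mathbb{R}^2_+: y_i(1-x_i)=0,\ i=1,2\}$. $\operatorname{cl}\operatorname{conv}$ denotes the closure of the convex hull. Division by zero convention: for a nonnegative numerator $q$, $q/0=+\infty$ if $q\ne 0$ and $q/0=0$ if $q=0$. *)

(* Defs.v *)
From mathcomp Require Import all_boot all_order all_algebra.
From mathcomp Require Import all_classical all_reals all_analysis.

Set Implicit Arguments.
Unset Strict Implicit.
Unset Printing Implicit Defensive.

Import Order.TTheory GRing.Theory Num.Theory.
Import numFieldNormedType.Exports.

Local Open Scope classical_set_scope.
Local Open Scope ring_scope.

Definition convex_hull (R : numDomainType) (M : lmodType R) (A : set M) :
    set M :=
  smallest (@convex_set R M) A.

(* The coordinates v_1, v_2 of v : 'rV[R]_2 are v 0 0 and v 0 1. *)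
Definition indicator_set (R : realType) : set ('rV[R]_2 * 'rV[R]_2) :=
  [set xy : 'rV[R]_2 * 'rV[R]_2 | forall i : 'I_2,
     [/\ xy.1 0 i = 0 \/ xy.1 0 i = 1,
         0 <= xy.2 0 i
       & xy.2 0 i * (1 - xy.1 0 i) = 0]].

Definition quad (R : realType) (d y : 'rV[R]_2) : R :=
  d 0 0 * y 0 0 ^+ 2 + 2 * y 0 0 * y 0 1 + d 0 1 * y 0 1 ^+ 2.

(* The last factor is R^o, i.e. R as a module over itself, so that the space
   of points (x, y, t) is a normed module over R. *)
Definition Zplus (R : realType) (d : 'rV[R]_2) :
    set ('rV[R]_2 * 'rV[R]_2 * R^o) :=
  [set p : 'rV[R]_2 * 'rV[R]_2 * R^o | let: (x, y, t) := p in
     [/\ indicator_set (x, y), 0 <= t & quad d y <= t]].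

(* The division of \bar R already follows the convention q / 0 = +oo for
   q > 0 and 0 / 0 = 0, and extends the division of R otherwise. *)
Lemma edivE (R : realType) (q r : R) : 0 <= q ->
  (q%:E / r%:E)%E =
  if r == 0 then if q == 0 then 0%E else +oo%E else (q / r)%:E.
Proof.
move=> q_ge0; rewrite inver; have [_|//] := eqVneq r 0.
have [->|q_neq0] := eqVneq q 0; first by rewrite mul0e.
by rewrite gt0_muley// lte_fin lt_neqAle eq_sym q_neq0.
Qed.

(* Main.v *)
Require Import Defs.
From mathcomp Require Import all_boot all_order all_algebra.
From mathcomp Require Import all_classical all_reals all_analysis.
From mathcomp Require Import ring lra.
Import Order.TTheory GRing.Theory Num.Theory.
Import numFieldNormedType.Exports.
Local Open Scope classical_set_scope.
Local Open Scope ring_scope.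

(** The set on the right-hand side is the projection of a set of witnesses
    that is convex and closed, and each of its points is an explicit convex
    combination of points of [Zplus d]; so the convex hull is already closed
    and equal to it.

    A point of the hull splits as a combination of four points of [Zplus d],
    one for each support (1,1), (1,0), (0,1), (0,0) of the indicators.  If
    [l] is the weight of (1,1), the weights of the others are forced to be
    [x1 - l], [x2 - l] and [1 - x1 - x2 + l], and these are nonnegative exactly
    when [x1 + x2 - 1 <= l <= min x1 x2].  If [z] is the contribution of the
    (1,1) piece to [y], then [y - z] comes from the two singleton supports, and
    minimizing [t] over each piece gives the three quotients.

    Division is removed by giving each singleton quotient an upper bound [u_i]
    and the quotient over [l] the remaining budget [t - u_1 - u_2]: the
    inequality becomes three constraints [q <= s * u] with [s, u >= 0]
    (lemma [ediv_le_fin] shows that this also captures the convention for a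
    zero denominator).  This defines [lifted], where in addition [z <= y];
    replacing [z] by its minimum with [y] is harmless since all the
    coefficients of the quadratic form are nonnegative ([proj_liftedP]).

    - [lifted] is convex because [d_1 d_2 >= 1] makes the quadratic form
      positive semidefinite, and [q <= s * u] then defines a rotated
      second-order cone ([rotated_cone_convex], [convex_lifted]).
    - Its projection is closed because [lifted] is closed and the witnesses are
      locally bounded, so that compactness applies ([closed_proj_lifted]).
    - It contains [Zplus d], with [l = x1 * x2] and [z = l y]
      ([Zplus_lifted]); hence it contains the closed convex hull.
    - Conversely the four pieces can be read off a witness
      ([lifted_hull]); a piece of zero weight contributes nothing because the
      form is positive definite on the nonnegative orthant. *)

(** * Convex combinations, closed projections and quotients *)

Lemma forall_ord2 (P : 'I_2 -> Prop) : P 0 -> P 1 -> forall i, P i.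
Proof.
move=> P0 P1 [[|[|//]] lti].
- by rewrite (_ : Ordinal lti = 0)//; exact: val_inj.
- by rewrite (_ : Ordinal lti = 1)//; exact: val_inj.
Qed.

Lemma convex_setP (R : numDomainType) (M : lmodType R) (C : set M) :
  convex_set C <-> forall x y k, C x -> C y -> 0 <= k -> k <= 1 ->
    C (k *: x + (1 - k) *: y).
Proof.
split=> [cC x y k Cx Cy k_ge0 k_le1|cC x y k].
  have := cC x y (Itv01 k_ge0 k_le1).
  by rewrite !inE => /(_ Cx Cy).
rewrite !inE => Cx Cy; exact: cC.
Qed.

(** Normalizing by the total weight, rather than assuming it to be 1, gives an
    induction hypothesis that applies to the tail of the sequence as it is. *)
Lemma convex_set_wsum (R : numFieldType) (M : lmodType R) (C : set M)
    (s : seq (R * M)) :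
  convex_set C -> (forall e, e \in s -> 0 <= e.1 /\ C e.2) ->
  0 < \sum_(e <- s) e.1 ->
  C ((\sum_(e <- s) e.1)^-1 *: \sum_(e <- s) e.1 *: e.2).
Proof.
move=> /convex_setP cC; elim: s => [|[w a] s IHs] sC.
  by rewrite !big_nil ltxx.
rewrite !big_cons/=.
have [/= w_ge0 Ca] := sC _ (mem_head _ _).
have {}sC e : e \in s -> 0 <= e.1 /\ C e.2.
  by move=> es; apply: sC; rewrite in_cons es orbT.
have s_ge0 : 0 <= \sum_(e <- s) e.1.
  by rewrite big_seq sumr_ge0// => e /sC[].
have [s0|s_neq0] := eqVneq (\sum_(e <- s) e.1) 0.
  rewrite s0 addr0 => w_gt0.
  rewrite (_ : \sum_(e <- s) _ = 0) ?addr0; last first.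
    rewrite big_seq big1// => e es.
    move/eqP: s0; rewrite big_seq psumr_eq0; last by move=> i /sC[].
    by move=> /allP/(_ e es); rewrite es => /eqP ->; rewrite scale0r.
  by rewrite scalerA mulVf ?gt_eqF// scale1r.
have s_gt0 : 0 < \sum_(e <- s) e.1 by rewrite lt_neqAle eq_sym s_neq0.
have Cb := IHs sC s_gt0.
set W := \sum_(e <- s) e.1 in s_ge0 s_gt0 s_neq0 Cb *.
set S := \sum_(e <- s) _ in Cb *.
move=> wW_gt0; have wW_neq0 : w + W != 0 by rewrite gt_eqF.
have := cC a (W^-1 *: S) (w / (w + W)) Ca Cb.
rewrite (_ : _ + _ = (w + W)^-1 *: (w *: a + S)).
  apply; first by rewrite divr_ge0// ltW.
  by rewrite ler_pdivrMr// mul1r lerDl.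
rewrite scalerDr !scalerA [_^-1 * w]mulrC; congr (_ *: _ + _ *: _).
by rewrite -[1 in LHS](divff wW_neq0) -mulrBl addrC addKr mulrAC divff// mul1r.
Qed.

Lemma continuous_fst_comp (T U V : topologicalType) (f : T -> U * V) :
  continuous f -> continuous (fun p => (f p).1).
Proof. by move=> cf p; apply: (cvg_comp f fst); [exact: cf|exact: cvg_fst]. Qed.

Lemma continuous_snd_comp (T U V : topologicalType) (f : T -> U * V) :
  continuous f -> continuous (fun p => (f p).2).
Proof. by move=> cf p; apply: (cvg_comp f snd); [exact: cf|exact: cvg_snd]. Qed.

Lemma continuous_coord_comp (R : realType) (T : topologicalType)
    (f : T -> 'rV[R]_2) i :
  continuous f -> continuous (fun p => f p 0 i).
Proof.
move=> cf p; apply: (@continuous_comp _ _ _ f (fun v : 'rV[R]_2 => v 0 i)).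
  exact: cf.
exact: coord_continuous.
Qed.

Lemma near_lt_add1 (R : realType) (T : topologicalType) (f : T -> R) (p : T) :
  continuous f -> nbhs p [set p' | f p' < f p + 1].
Proof.
by move=> cf; apply: (cvgr_lt (f p) (cf p)); rewrite ltrDl ltr01.
Qed.

Lemma closed_le_fun (R : realType) (T : topologicalType) (f g : T -> R) :
  continuous f -> continuous g -> closed [set p | f p <= g p].
Proof.
move=> cf cg.
rewrite (_ : [set p | _] = (fun p => g p - f p) @^-1` [set r | 0 <= r]).
  apply: closed_comp; last exact: closed_ge.
  by move=> p _; apply: continuousB; [exact: cg|exact: cf].
by apply/seteqP; split=> p /=; rewrite subr_ge0.
Qed.

(** The tube lemma: over a neighborhood of [p] the fibres lie in one compact
    set [K], so if no point of [K] is above [p], then none is above any point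
    of a smaller neighborhood. *)
Lemma closed_fst_image (X Y : topologicalType) (S : set (X * Y)) :
  closed S ->
  (forall p : X, exists2 K : set Y, compact K &
     \forall p' \near p, forall q, S (p', q) -> K q) ->
  closed (fst @` S).
Proof.
move=> clS bndS p clp.
have [K /compact_near_coveringP cK pK] := bndS p.
apply: contrapT => Np.
have : \forall p' \near p, K `<=` (fun q => ~ S (p', q)).
  apply: (cK _ (nbhs p) (fun p' q => ~ S (p', q))) => q _.
  have /= : nbhs (p, q) (~` S).
    apply: open_nbhs_nbhs; split; first exact: closed_openC.
    by move=> Spq; apply: Np; exists (p, q).
  move=> [[A B]/= [pA qB] ABS]; exists (B, A) => //= -[q' p'] /= [Bq' Ap'].
  exact: (ABS (p', q')).
move=> NS; have [_ [[[p' q] Spq <-] [Kp' Np']]] := clp _ (filterI pK NS).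
exact: (Np' q (Kp' _ Spq)).
Qed.

(** For [s = 0] the right-hand side forces [q = 0], in agreement with
    [0 / 0 = 0] and [q / 0 = +oo]; the conjunct [0 <= u] is what remains of the
    inequality in that case. *)
Lemma ediv_le_fin (R : realType) (q s u : R) : 0 <= q -> 0 <= s ->
  (q%:E / s%:E <= u%:E)%E = (0 <= u) && (q <= s * u).
Proof.
move=> q_ge0 s_ge0; rewrite edivE//.
have [->|s_neq0] := eqVneq s 0.
  rewrite mul0r; have [->|q_neq0] := eqVneq q 0.
    by rewrite lexx andbT lee_fin.
  by rewrite leye_eq/= [q <= 0]le_eqVlt (negbTE q_neq0) ltNge q_ge0 andbF.
have s_gt0 : 0 < s by rewrite lt_neqAle eq_sym s_neq0.
rewrite lee_fin ler_pdivrMr// [u * s]mulrC.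
have [qsu|//] := boolP (q <= s * u); last by rewrite andbF.
by rewrite andbT -(pmulr_rge0 _ s_gt0) (le_trans q_ge0).
Qed.

(** A piece of weight [s] placed at a vector divided by [s] costs [s] times the
    form at that vector, which the cone constraint bounds by [u], also when
    [s = 0]. *)
Lemma mulr_div_cone (R : realType) (q s u : R) :
  0 <= s -> 0 <= u -> q <= s * u ->
  s * (q / s ^+ 2) <= u.
Proof.
move=> s_ge0 u_ge0 qsu; have [->|s_neq0] := eqVneq s 0; first by rewrite mul0r.
have s_gt0 : 0 < s by rewrite lt_neqAle eq_sym s_neq0.
rewrite [leLHS](_ : _ = q / s); first by rewrite ler_pdivrMr// mulrC.
by field.
Qed.

Lemma ge0_adde_le_fin (R : realType) (a b c : \bar R) (t : R) :
  (0 <= a)%E -> (0 <= b)%E -> (a + b + c <= t%:E)%E -> (0 <= c)%E ->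
  exists u v, [/\ (a <= u%:E)%E, (b <= v%:E)%E & (c <= (t - u - v)%:E)%E].
Proof.
case: a => [a||]//; case: b => [b||]//; case: c => [c||]//=.
move=> _ _ abct _; exists a, b; split=> //.
by move: abct; rewrite !lee_fin; lra.
Qed.

(** The mixed term of a sum of two elements of a rotated cone: by hypothesis
    [b ^+ 2 <= (s * u') * (s' * u)], and the arithmetic mean of these two
    factors dominates their geometric mean. *)
Lemma cross_le (R : realFieldType) (q q' b s s' u u' : R) :
  0 <= q -> 0 <= q' -> 0 <= s -> 0 <= s' -> 0 <= u -> 0 <= u' ->
  q <= s * u -> q' <= s' * u' -> b ^+ 2 <= q * q' ->
  2 * b <= s * u' + s' * u.
Proof.
move=> q0 q'0 s0 s'0 u0 u'0 qsu q'su' bqq'.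
have su0 : 0 <= s * u' + s' * u by rewrite addr_ge0 ?mulr_ge0.
have [b0|b0] := ltP b 0; first by apply: le_trans su0; lra.
rewrite -ler_sqr ?nnegrE ?mulr_ge0//.
have := ler_pM q0 q'0 qsu q'su'.
have := sqr_ge0 (s * u' - s' * u).
by rewrite !expr2 in bqq' *; nra.
Qed.

(** With [q] and [q'] the values of a semidefinite form at two vectors and [b]
    its polar form, the left-hand side is the value at the combination of the
    vectors, so this is the convexity of the cone [q <= s * u]; the hypothesis
    on [b] is the Cauchy-Schwarz inequality. *)
Lemma rotated_cone_convex (R : realFieldType) (q q' b s s' u u' a c : R) :
  0 <= q -> 0 <= q' -> 0 <= s -> 0 <= s' -> 0 <= u -> 0 <= u' ->
  q <= s * u -> q' <= s' * u' -> b ^+ 2 <= q * q' -> 0 <= a -> 0 <= c ->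
  a ^+ 2 * q + 2 * a * c * b + c ^+ 2 * q' <=
  (a * s + c * s') * (a * u + c * u').
Proof.
move=> q0 q'0 s0 s'0 u0 u'0 qsu q'su' bqq' a0 c0.
have h := cross_le _ _ _ _ _ _ _ _ q0 q'0 s0 s'0 u0 u'0 qsu q'su' bqq'.
have h1 := ler_wpM2l (sqr_ge0 a) qsu.
have h2 := ler_wpM2l (sqr_ge0 c) q'su'.
have h3 := ler_wpM2l (mulr_ge0 a0 c0) h.
by rewrite !expr2 in h1 h2 *; lra.
Qed.

(** * The quadratic form *)

Section ConvexHullOfZplus.
Context (R : realType) (d : 'rV[R]_2).
Hypotheses (d1_ge0 : 0 <= d 0 0) (d2_ge0 : 0 <= d 0 1)
  (d12_ge1 : 1 <= d 0 0 * d 0 1).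

Lemma d_gt0 i : 0 < d 0 i.
Proof.
have d12_neq0 : d 0 0 * d 0 1 != 0 by rewrite gt_eqF// (lt_le_trans ltr01).
move: d12_neq0; rewrite mulf_eq0 negb_or => /andP[d1_neq0 d2_neq0].
by move: i; apply: forall_ord2; rewrite lt_neqAle eq_sym ?d1_neq0 ?d2_neq0.
Qed.

Definition quad_polar (v w : 'rV[R]_2) : R :=
  d 0 0 * (v 0 0 * w 0 0) + (v 0 0 * w 0 1 + v 0 1 * w 0 0)
  + d 0 1 * (v 0 1 * w 0 1).

(** Completing the square in [d_1 q] leaves the factor [d_1 d_2 - 1]. *)
Lemma quad_ge0 v : 0 <= quad d v.
Proof.
rewrite /quad -(pmulr_rge0 _ (d_gt0 0)).
rewrite [leRHS](_ : _ = (d 0 0 * v 0 0 + v 0 1) ^+ 2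
                        + (d 0 0 * d 0 1 - 1) * v 0 1 ^+ 2); last by ring.
by rewrite addr_ge0 ?sqr_ge0// mulr_ge0 ?sqr_ge0// subr_ge0.
Qed.

(** Lagrange's identity: the difference is [d_1 d_2 - 1] times the square of a
    determinant. *)
Lemma quad_cauchy_schwarz v w : quad_polar v w ^+ 2 <= quad d v * quad d w.
Proof.
rewrite -subr_ge0 /quad_polar /quad.
rewrite [leRHS](_ : _ = (d 0 0 * d 0 1 - 1)
  * (v 0 0 * w 0 1 - v 0 1 * w 0 0) ^+ 2); last by ring.
by rewrite mulr_ge0 ?sqr_ge0// subr_ge0.
Qed.

Lemma quad_comb (a c : R) v w : quad d (a *: v + c *: w) =
  a ^+ 2 * quad d v + 2 * a * c * quad_polar v w + c ^+ 2 * quad d w.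
Proof. by rewrite /quad /quad_polar !mxE; ring. Qed.

Lemma quadZ (a : R) v : quad d (a *: v) = a ^+ 2 * quad d v.
Proof. by rewrite /quad !mxE; ring. Qed.

Lemma quad_delta i : quad d (delta_mx 0 i) = d 0 i.
Proof. by move: i; apply: forall_ord2; rewrite /quad !mxE/=; ring. Qed.

Lemma quad_mono (v w : 'rV[R]_2) :
  (forall i, 0 <= v 0 i <= w 0 i) -> quad d v <= quad d w.
Proof.
move=> vw; have /andP[v0 vw0] := vw 0; have /andP[v1 vw1] := vw 1.
rewrite /quad; apply: lerD; first apply: lerD.
- by rewrite ler_wpM2l// lerXn2r// nnegrE// (le_trans v0).
- by rewrite ler_pM// ?mulr_ge0// ler_wpM2l.
- by rewrite ler_wpM2l// lerXn2r// nnegrE// (le_trans v1).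
Qed.

(** On the whole plane the form is only semidefinite when [d_1 d_2 = 1]; on the
    nonnegative orthant the cross term helps and the form is definite. *)
Lemma quad_le0 (v : 'rV[R]_2) :
  (forall i, 0 <= v 0 i) -> quad d v <= 0 -> v = 0.
Proof.
move=> v_ge0 qv; apply/rowP; rewrite /quad in qv.
have h0 := sqr_ge0 (v 0 0); have h1 := sqr_ge0 (v 0 1).
have h01 := mulr_ge0 (v_ge0 0) (v_ge0 1).
have g0 := mulr_ge0 d1_ge0 h0; have g1 := mulr_ge0 d2_ge0 h1.
apply: forall_ord2; rewrite mxE; apply/eqP; rewrite -sqrf_eq0.
- have /eqP : d 0 0 * v 0 0 ^+ 2 = 0 by lra.
  by rewrite mulf_eq0 gt_eqF ?d_gt0.
- have /eqP : d 0 1 * v 0 1 ^+ 2 = 0 by lra.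
  by rewrite mulf_eq0 gt_eqF ?d_gt0.
Qed.

(** * The lifted set *)

(** A point [(x, y, t)] together with a witness [(l, z, u)] of its membership
    in the hull: [u 0 i] bounds the quotient over [x 0 i - l], leaving
    [t - u 0 0 - u 0 1] for the one over [l].  The bound [z <= y] keeps the
    witnesses of a bounded set of points bounded. *)
Definition lifted : set (('rV[R]_2 * 'rV[R]_2 * R^o) *
                         (R^o * 'rV[R]_2 * 'rV[R]_2)) :=
  [set pq : ('rV[R]_2 * 'rV[R]_2 * R^o) * (R^o * 'rV[R]_2 * 'rV[R]_2) |
     let: ((x, y, t), (l, z, u)) := pq in
     [/\ 0 <= l /\ x 0 0 + x 0 1 - 1 <= l,
         forall i : 'I_2,
           [/\ l <= x 0 i, 0 <= z 0 i, z 0 i <= y 0 i & 0 <= u 0 i],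
         forall i : 'I_2, d 0 i * (y 0 i - z 0 i) ^+ 2 <= (x 0 i - l) * u 0 i,
         0 <= t - u 0 0 - u 0 1
       & quad d z <= l * (t - u 0 0 - u 0 1)]].

Lemma convex_lifted : convex_set (fst @` lifted).
Proof.
apply/convex_setP => _ _ k [[[[x y] t] [[l z] u]] h <-]
  [[[[x' y'] t'] [[l' z'] u']] h' <-] k0 k1.
move: h h' => /= [[l0 xl] hi hd ht hq] [[l'0 xl'] h'i h'd h't h'q].
have c0 : 0 <= 1 - k by rewrite subr_ge0.
set c := 1 - k in c0 *; have kc : k + c = 1 by rewrite addrC subrK.
exists ((k *: x + c *: x', k *: y + c *: y', k *: t + c *: t'),
  (k *: l + c *: l', k *: z + c *: z', k *: u + c *: u')) => //=.
have comb_ge0 (a b : R) : 0 <= a -> 0 <= b -> 0 <= k * a + c * b.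
  by move=> a0 b0; rewrite addr_ge0 ?mulr_ge0.
have comb_le (a a' b b' : R) : a <= a' -> b <= b' ->
    k * a + c * b <= k * a' + c * b'.
  by move=> aa' bb'; rewrite lerD ?ler_wpM2l.
split.
- split; first exact: comb_ge0.
  apply: le_trans (comb_le _ _ _ _ xl xl').
  by rewrite !mxE -[X in _ - X]kc le_eqVlt; apply/orP; left; apply/eqP; ring.
- move=> i; have [a1 a2 a3 a4] := hi i; have [b1 b2 b3 b4] := h'i i.
  by rewrite !mxE; split; [exact: comb_le|exact: comb_ge0|exact: comb_le|
    exact: comb_ge0].
- move=> i; have [a1 a2 a3 a4] := hi i; have [b1 b2 b3 b4] := h'i i.
  have sq (w : R) : 0 <= d 0 i * w ^+ 2.
    by rewrite mulr_ge0 ?sqr_ge0// ltW ?d_gt0.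
  have := rotated_cone_convex _ _ _
   (d 0 i * ((y 0 i - z 0 i) * (y' 0 i - z' 0 i)))
   _ _ _ _ _ _ (sq _) (sq _) _ _ a4 b4 (hd i) (h'd i) _ k0 c0.
  rewrite !subr_ge0 => /(_ a1 b1).
  rewrite [X in X <= _](_ : _ = (d 0 i * (y 0 i - z 0 i) ^+ 2) *
    (d 0 i * (y' 0 i - z' 0 i) ^+ 2)); last by ring.
  move=> /(_ (lexx _)); rewrite !mxE.
  rewrite [leLHS](_ : _ = d 0 i *
    (k * y 0 i + c * y' 0 i - (k * z 0 i + c * z' 0 i)) ^+ 2); last by ring.
  by move/le_trans; apply; rewrite le_eqVlt; apply/orP; left; apply/eqP => /=;
    rewrite /GRing.scale/=; ring.
- rewrite !mxE /GRing.scale/=.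
  rewrite [leRHS](_ : _ = k * (t - u 0 0 - u 0 1) + c * (t' - u' 0 0 - u' 0 1)).
    exact: comb_ge0.
  by ring.
- rewrite quad_comb.
  have := rotated_cone_convex _ _ _ (quad_polar z z') _ _ _ _ _ _
    (quad_ge0 z) (quad_ge0 z') l0 l'0 ht h't hq h'q
    (quad_cauchy_schwarz _ _) k0 c0.
  move/le_trans; apply; rewrite le_eqVlt; apply/orP; left; apply/eqP => /=.
  by rewrite !mxE /GRing.scale/=; ring.
Qed.

Let E : Type :=
  (('rV[R]_2 * 'rV[R]_2 * R^o) * (R^o * 'rV[R]_2 * 'rV[R]_2))%type.

Lemma closed_lifted : closed lifted.
Proof.
have cD (f g : E -> R) : continuous f -> continuous g ->
    continuous (fun pq => f pq + g pq).
  by move=> cf cg pq; apply: cvgD; [exact: cf|exact: cg].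
have cB (f g : E -> R) : continuous f -> continuous g ->
    continuous (fun pq => f pq - g pq).
  by move=> cf cg pq; apply: cvgB; [exact: cf|exact: cg].
have cM (f g : E -> R) : continuous f -> continuous g ->
    continuous (fun pq => f pq * g pq).
  by move=> cf cg pq; apply: cvgM; [exact: cf|exact: cg].
(* Squares are written as products, so that the continuity of each side follows
   from that of products. *)
have -> : lifted =
  [set pq : E | 0 <= (pq.2.1.1 : R)] `&`
  [set pq : E | pq.1.1.1 0 0 + pq.1.1.1 0 1 - 1 <= (pq.2.1.1 : R)] `&`
  \bigcap_(i : 'I_2) (
    [set pq : E | (pq.2.1.1 : R) <= pq.1.1.1 0 i] `&`
    [set pq : E | 0 <= pq.2.1.2 0 i] `&`
    [set pq : E | pq.2.1.2 0 i <= pq.1.1.2 0 i] `&`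
    [set pq : E | 0 <= pq.2.2 0 i] `&`
    [set pq : E | d 0 i * ((pq.1.1.2 0 i - pq.2.1.2 0 i)
                           * (pq.1.1.2 0 i - pq.2.1.2 0 i))
                  <= (pq.1.1.1 0 i - pq.2.1.1) * pq.2.2 0 i]) `&`
  [set pq : E | 0 <= (pq.1.2 - pq.2.2 0 0 - pq.2.2 0 1 : R)] `&`
  [set pq : E | d 0 0 * (pq.2.1.2 0 0 * pq.2.1.2 0 0)
      + 2 * pq.2.1.2 0 0 * pq.2.1.2 0 1
      + d 0 1 * (pq.2.1.2 0 1 * pq.2.1.2 0 1)
      <= (pq.2.1.1 : R) * (pq.1.2 - pq.2.2 0 0 - pq.2.2 0 1)].
  apply/seteqP; split=> -[[[x y] t] [[l z] u]] /=.
    move=> [[? ?] hi hd ? ?]; split=> //; split=> //; split=> // i _.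
    by have [? ? ? ?] := hi i; do 4?split => //; exact: hd.
  move=> [[[[? ?] hi] ?] ?]; split=> // i; have := hi i I.
    by move=> [[[[? ?] ?] ?] ?].
  by move=> [].
have closed_le (f g : E -> R) : continuous f -> continuous g ->
  closed [set pq : E | f pq <= g pq] by exact: closed_le_fun.
do 4?apply: closedI.
all: match goal with
 | |- closed (bigcap _ _) => apply: closed_bigI => i _; do 4?apply: closedI
 | _ => idtac end.
all: apply: closed_le.
all: repeat match goal with
 | |- continuous (fun=> _) => move=> ?; exact: cvg_cst
 | |- continuous (fun pq => @?f pq - @?g pq) => apply: (cB f g)
 | |- continuous (fun pq => @?f pq + @?g pq) => apply: (cD f g)
 | |- continuous (fun pq => @?f pq * @?g pq) => apply: (cM f g)
 | |- continuous (fun pq => fun_of_matrix (@?f pq) _ _) =>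
   apply: (continuous_coord_comp _ _ f)
 | |- continuous (fun pq => fst (@?f pq)) =>
   apply: (continuous_fst_comp _ _ _ f)
 | |- continuous (fun pq => snd (@?f pq)) =>
   apply: (continuous_snd_comp _ _ _ f)
 | |- continuous (fun pq => pq) => move=> ?; exact: cvg_id
 end.
Qed.

(** Near [(x, y, t)] the witnesses satisfy [0 <= l <= 1],
    [0 <= z <= y + 1] and [0 <= u <= t + 1]. *)
Lemma closed_proj_lifted : closed (fst @` lifted).
Proof.
apply: closed_fst_image; first exact: closed_lifted.
move=> [[x y] t].
exists ((`[0, 1]%classic : set R^o)
  `*` [set z : 'rV[R]_2 | forall i, `[0, y 0 i + 1]%classic (z 0 i)]
  `*` [set u : 'rV[R]_2 | forall i : 'I_2, `[0, t + 1]%classic (u 0 i)]).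
  apply: compact_setX; first apply: compact_setX.
  - exact: segment_compact.
  - exact: (@rV_compact R 2 (fun i => `[0, y 0 i + 1]%classic)
      (fun i => @segment_compact _ _ _)).
  - exact: (@rV_compact R 2 (fun i => `[0, t + 1]%classic)
      (fun i => @segment_compact _ _ _)).
pose T : Type := ('rV[R]_2 * 'rV[R]_2 * R^o)%type.
have ny (i : 'I_2) : nbhs (x, y, t) [set p' : T | p'.1.2 0 i < y 0 i + 1].
  apply: (near_lt_add1 _ _ (fun p' : T => p'.1.2 0 i)).
  by do [apply: continuous_coord_comp; apply: continuous_snd_comp] => ?;
    exact: cvg_fst.
have nt : nbhs (x, y, t) [set p' : T | (p'.2 : R) < t + 1].
  by apply: (near_lt_add1 _ _ (fun p' : T => p'.2 : R)) => ?; exact: cvg_snd.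
apply: filterS (filterI (ny 0) (filterI (ny 1) nt)).
move=> [[x' y'] t'] /= [y0 [y1 t1]] [[l z] u] [[l0 xl] hi _ ht _].
have [a1 a2 a3 a4] := hi 0; have [b1 b2 b3 b4] := hi 1.
split; [split|].
- by rewrite /= in_itv/=; apply/andP; split; lra.
- by move=> /=; apply: forall_ord2; rewrite in_itv/=; apply/andP; split; lra.
- by move=> /=; apply: forall_ord2; rewrite in_itv/=; apply/andP; split; lra.
Qed.

(** * Comparison with the convex hull *)

(** For binary [x] the weight of the support (1,1) is [x 0 0 * x 0 1], and
    the support of [x] itself carries the whole of [y]. *)
Lemma Zplus_lifted : Zplus d `<=` fst @` lifted.
Proof.
move=> [[x y] t]; rewrite /Zplus/= => -[xy t0 qt].
have hx i : x 0 i = 0 /\ y 0 i = 0 \/ x 0 i = 1.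
  have [[xi _ xy0|xi _ _]] := xy i; [left|by right].
  by move: xy0; rewrite xi subr0 mulr1.
have hy i : 0 <= y 0 i by have [] := xy i.
pose l := x 0 0 * x 0 1.
exists ((x, y, t),
  (l, l *: y, \row_i ((x 0 i - l) * (d 0 i * y 0 i ^+ 2)))) => //.
rewrite /lifted/=; rewrite /quad in qt.
have h0 := mulr_ge0 d1_ge0 (sqr_ge0 (y 0 0)).
have h1 := mulr_ge0 d2_ge0 (sqr_ge0 (y 0 1)).
have y0 := hy 0; have y1 := hy 1.
rewrite /l /quad !mxE; split.
- by have [[-> _]|->] := hx 0; have [[-> _]|->] := hx 1; split; lra.
- apply: forall_ord2; rewrite !mxE;
  by have [[-> e]|->] := hx 0; have [[-> e']|->] := hx 1;
     rewrite ?e ?e' in h0 h1 y0 y1 *; split; lra.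
- apply: forall_ord2; rewrite !mxE;
  by have [[-> e]|->] := hx 0; have [[-> e']|->] := hx 1;
     rewrite ?e ?e' in h0 h1 y0 y1 *; lra.
- by have [[-> e]|->] := hx 0; have [[-> e']|->] := hx 1;
     rewrite ?e ?e' in qt h0 h1 y0 y1 *; lra.
- by have [[-> e]|->] := hx 0; have [[-> e']|->] := hx 1;
     rewrite ?e ?e' in qt h0 h1 y0 y1 *; lra.
Qed.

(** The four pieces, of weights [l], [x 0 0 - l], [x 0 1 - l] and
    [1 - x 0 0 - x 0 1 + l], sit at [z / l], at the two points
    [(y 0 i - z 0 i) / (x 0 i - l)] of the axes, and at the origin. *)
Lemma lifted_hull : fst @` lifted `<=` convex_hull (Zplus d).
Proof.
move=> _ [[[[x y] t] [[l z] u]] /= [[l0 xl] hi hd ht hq] <-] C [cC ZC].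
set s := t - u 0 0 - u 0 1 in ht hq.
have s01 i : 0 <= x 0 i - l by have [] := hi i; rewrite subr_ge0.
pose c i := (y 0 i - z 0 i) / (x 0 i - l).
have cE i : (x 0 i - l) * c i = y 0 i - z 0 i.
  have [x0|x0] := eqVneq (x 0 i - l) 0; last by rewrite /c mulrC divfK.
  have /eqP := hd i; rewrite x0 mul0r mul0r => /eqP hd0.
  apply/eqP; rewrite eq_sym -sqrf_eq0 eq_le sqr_ge0 andbT.
  by rewrite -(pmulr_rle0 _ (d_gt0 i)).
have lE : l *: (l^-1 *: z) = z.
  have [l_eq0|l_neq0] := eqVneq l 0; last by rewrite scalerA divff// scale1r.
  rewrite l_eq0 scale0r [RHS]quad_le0//; first by move=> i; have [] := hi i.
  by rewrite l_eq0 mul0r in hq.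
(* The slack of [t] is added to the last coordinate of every piece: the
   weights sum to 1. *)
pose r := t - (l * quad d (l^-1 *: z)
  + (x 0 0 - l) * quad d (c 0 *: delta_mx 0 0)
  + (x 0 1 - l) * quad d (c 1 *: delta_mx 0 1)).
have r0 : 0 <= r.
  have h0 : l * quad d (l^-1 *: z) <= s.
    by rewrite quadZ exprVn [_^-1 * _]mulrC mulr_div_cone.
  have h i : (x 0 i - l) * quad d (c i *: delta_mx 0 i) <= u 0 i.
    rewrite quadZ quad_delta expr_div_n mulrAC [_ * d 0 i]mulrC.
    by rewrite mulr_div_cone//; have [] := hi i.
  by rewrite /r; have := h 0; have := h 1; rewrite /s in h0; lra.
pose pt (v w : 'rV[R]_2) : 'rV[R]_2 * 'rV[R]_2 * R^o := (v, w, quad d w + r).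
have ptC v w : indicator_set (v, w) -> C (pt v w).
  move=> vw; apply: ZC; split=> //; last by rewrite lerDl.
  by rewrite addr_ge0// quad_ge0.
pose S : seq (R * ('rV[R]_2 * 'rV[R]_2 * R^o)) :=
  [:: (l, pt (const_mx 1) (l^-1 *: z));
      (x 0 0 - l, pt (delta_mx 0 0) (c 0 *: delta_mx 0 0));
      (x 0 1 - l, pt (delta_mx 0 1) (c 1 *: delta_mx 0 1));
      (1 - x 0 0 - x 0 1 + l, pt 0 0)].
have S1 : \sum_(e <- S) e.1 = 1 by rewrite /S !big_cons big_nil/=; ring.
have := convex_set_wsum _ _ _ S cC; rewrite S1 invr1 scale1r ltr01 => SC.
rewrite (_ : (x, y, t) = \sum_(e <- S) e.1 *: e.2).
  apply: SC => // e.
  have c0 i : 0 <= c i.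
    by have [_ _ zy _] := hi i; rewrite divr_ge0// subr_ge0.
  rewrite !inE => /or4P[] /eqP -> /=; (split; last apply: ptC).
  - by [].
  - move=> i; rewrite /= !mxE; split; [by right| |by rewrite subrr mulr0].
    by have [_ z0 _ _] := hi i; rewrite mulr_ge0// invr_ge0.
  - exact: s01.
  - by apply: forall_ord2; rewrite /= !mxE/= ?(mulr1, mulr0, mul0r, subrr);
       split=> //; [right|left].
  - exact: s01.
  - by apply: forall_ord2; rewrite /= !mxE/= ?(mulr1, mulr0, mul0r, subrr);
       split=> //; [left|right].
  - lra.
  - by move=> i; rewrite /= !mxE mul0r; split=> //; left.
rewrite /S !big_cons big_nil/= /pt.
have q0 : quad d 0 = 0 by rewrite /quad !mxE; ring.
congr (_, _, _).
- by apply/rowP; apply: forall_ord2; rewrite !mxE/=; ring.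
- transitivity (l *: (l^-1 *: z) + ((x 0 0 - l) *: (c 0 *: delta_mx 0 0)
    + ((x 0 1 - l) *: (c 1 *: delta_mx 0 1)
    + ((1 - x 0 0 - x 0 1 + l) *: 0 + 0))) : 'rV[R]_2); last by [].
  rewrite lE scaler0 !addr0; apply/rowP; apply: forall_ord2;
    rewrite !mxE/= !(mulr0, mulr1, addr0, add0r) cE; ring.
- transitivity ((l : R) * (quad d (l^-1 *: z) + r)
    + ((x 0 0 - l) * (quad d (c 0 *: delta_mx 0 0) + r)
    + ((x 0 1 - l) * (quad d (c 1 *: delta_mx 0 1) + r)
    + ((1 - x 0 0 - x 0 1 + l) * (quad d 0 + r) + 0)))); last by [].
  rewrite q0 /r; ring.
Qed.

(** A witness that does not satisfy [z <= y] is replaced by the minimum of [z]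
    and [y], which can only decrease each numerator. *)
Lemma proj_liftedP (x y : 'rV[R]_2) (t : R^o) :
  (fst @` lifted) (x, y, t) <->
    [/\ forall i : 'I_2, 0 <= x 0 i <= 1,
        forall i : 'I_2, 0 <= y 0 i,
        0 <= t
      & exists (lambda : R) (z : 'rV[R]_2),
        [/\ 0 <= lambda,
            forall i : 'I_2, 0 <= z 0 i,
            x 0 0 + x 0 1 - 1 <= lambda <= Num.min (x 0 0) (x 0 1)
          & ((d 0 0 * (y 0 0 - z 0 0) ^+ 2)%:E / (x 0 0 - lambda)%:E
             + (d 0 1 * (y 0 1 - z 0 1) ^+ 2)%:E / (x 0 1 - lambda)%:E
             + (quad d z)%:E / lambda%:E <= t%:E)%E]].
Proof.
have sq i (w : R) : 0 <= d 0 i * w ^+ 2.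
  by rewrite mulr_ge0 ?sqr_ge0// ltW ?d_gt0.
split.
  move=> [[[[x' y'] t'] [[l z] u]] /= [[l0 xl] hi hd ht hq] [<- <- <-]].
  have [a1 a2 a3 a4] := hi 0; have [b1 b2 b3 b4] := hi 1.
  split.
  - by apply: forall_ord2; apply/andP; split; lra.
  - by move=> i; have [_ z0 zy _] := hi i; exact: le_trans zy.
  - by lra.
  exists l, z; split=> //.
  - by move=> i; have [] := hi i.
  - by rewrite xl le_min a1 b1.
  rewrite (_ : t' = u 0 0 + u 0 1 + (t' - u 0 0 - u 0 1)); last by ring.
  rewrite !EFinD; apply: leeD; first apply: leeD.
  - by rewrite ediv_le_fin ?subr_ge0// a4 hd.
  - by rewrite ediv_le_fin ?subr_ge0// b4 hd.
  - by rewrite -!EFinD ediv_le_fin ?quad_ge0// ht hq.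
move=> [hx hy t0 [l [z [l0 hz /andP[xl]]]]].
rewrite le_min => /andP[lx0 lx1] hsum.
pose z' : 'rV[R]_2 := \row_i Num.min (z 0 i) (y 0 i).
have ediv_ge0 (q s : R) : 0 <= q -> 0 <= s -> (0 <= q%:E / s%:E :> \bar R)%E.
  move=> q_ge0 s_ge0; rewrite edivE//; case: ifP => _; last first.
    by rewrite lee_fin divr_ge0.
  by case: ifP => _; rewrite ?leey.
have [u0 [u1 []]] := ge0_adde_le_fin _ _ _ _ _
  (ediv_ge0 _ _ (sq 0 (y 0 0 - z 0 0)) (etrans (subr_ge0 _ _) lx0))
  (ediv_ge0 _ _ (sq 1 (y 0 1 - z 0 1)) (etrans (subr_ge0 _ _) lx1))
  hsum (ediv_ge0 _ _ (quad_ge0 z) l0).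
rewrite !ediv_le_fin ?subr_ge0 ?quad_ge0//.
move=> /andP[u0_ge0 h0] /andP[u1_ge0 h1] /andP[ht hq].
exists ((x, y, t), (l, z', \row_i (if i == 0 then u0 else u1))) => //=.
have sq_le i : d 0 i * (y 0 i - z' 0 i) ^+ 2 <= d 0 i * (y 0 i - z 0 i) ^+ 2.
  rewrite ler_wpM2l ?(ltW (d_gt0 i))// mxE.
  by have [_|_] := leP (z 0 i) (y 0 i); rewrite ?subrr ?expr0n ?sqr_ge0.
rewrite !mxE/=; split=> //.
- by apply: forall_ord2;
    rewrite !mxE/= ge_min lexx orbT le_min ?hz ?hy; split.
- by apply: forall_ord2; rewrite [X in _ <= _ * X]mxE/=;
    apply: le_trans (sq_le _) _.
- by rewrite subr_ge0.
- apply: le_trans hq; apply: quad_mono => i.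
  by rewrite mxE le_min hz hy ge_min lexx.
Qed.

End ConvexHullOfZplus.

Theorem proposition1 (R : realType) (d : 'rV[R]_2)
    (d1_ge0 : 0 <= d 0 0) (d2_ge0 : 0 <= d 0 1) (d12_ge1 : 1 <= d 0 0 * d 0 1) :
  closure (convex_hull (Zplus d)) =
  [set p : 'rV[R]_2 * 'rV[R]_2 * R^o | let: (x, y, t) := p in
    [/\ forall i : 'I_2, 0 <= x 0 i <= 1,
        forall i : 'I_2, 0 <= y 0 i,
        0 <= t
      & exists (lambda : R) (z : 'rV[R]_2),
        [/\ 0 <= lambda,
            forall i : 'I_2, 0 <= z 0 i,
            x 0 0 + x 0 1 - 1 <= lambda <= Num.min (x 0 0) (x 0 1)
          & ((d 0 0 * (y 0 0 - z 0 0) ^+ 2)%:E / (x 0 0 - lambda)%:E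
             + (d 0 1 * (y 0 1 - z 0 1) ^+ 2)%:E / (x 0 1 - lambda)%:E
             + (quad d z)%:E / lambda%:E <= t%:E)%E]]].
Proof.
rewrite [RHS](_ : _ = fst @` lifted R d); last first.
  by apply/seteqP; split=> -[[x y] t] /proj_liftedP; apply.
apply/seteqP; split.
  apply: subset_trans (closed_proj_lifted R d); apply: closureS.
  apply: smallest_sub; first exact: convex_lifted.
  exact: Zplus_lifted.
apply: subset_trans (@subset_closure _ _).
exact: lifted_hull.
Qed.
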